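(* Let $\alpha_0,\alpha_1$ be complex parameters with $2\alpha_0+\alpha_1=1$, and consider the system $$\frac{dx}{dt}=x^4y+\alpha_0x^3+\frac t2x^2+1,\qquad \frac{dy}{dt}=-2x^3y^2-3\alpha_0x^2y-txy-\alpha_0^2x-\frac{\alpha_0t}{2}.$$ This system admits affine Weyl group symmetry of type $A_2^{(2)}$ as a group of Bäcklund transformations, with generators acting on $(x,y,t;\alpha_0,\alpha_1)$ by \begin{align*} s_0:&\ \to \left(x+\tfrac{\alpha_0}{y},\,y,\,t;\,-\alpha_0,\alpha_1+4\alpha_0\right),\\ s_1:&\ \to \left(-x,\,-y+\tfrac{\alpha_1}{x}-\tfrac{t}{x^2}-\tfrac{2}{x^4},\,t;\,\alpha_0+\alpha_1,-\alpha_1\right). \end{align*} That is: $s_0$ and $s_1$ are Bäcklund transformations of the system, and the group they generate is the affine Weyl group of type $A_2^{(2)}$ with $s_0,s_1$ as simple reflections (defining relations $s_0^2=s_1^2=1$ only).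
   Context: A transformation $(x,y,t;\alpha)\mapsto(x',y',t';\alpha')$, with $x',y',t'$ rational in $x,y,t,\alpha$, is a Bäcklund transformation of the system if, whenever $(x(t),y(t))$ solves the system with parameters $\alpha$, the pair $(x',y')$, viewed as a function of the independent variable $t'$ (where defined), solves the same system with parameters $\alpha'$. Such transformations are composed as automorphisms of the field of rational functions in $x,y,t$ and the parameters (subject to their linear relation): e.g. $s_0(x)=x+\alpha_0/y$, $s_0(\alpha_1)=\alpha_1+4\alpha_0$. *)

(* Defs.v *)
From HB Require Import structures.
From mathcomp Require Import all_boot all_order all_algebra.
From mathcomp Require Import complex fraction.
From mathcomp Require Import all_classical all_reals all_analysis.
From mathcomp Require mpoly.
(* The notations of mpoly clash with those of mathcomp-analysis. *)
Import -(notations) mpoly.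
Import numFieldNormedType.Exports.
Import Order.TTheory GRing.Theory Num.Theory.

Set Implicit Arguments.
Unset Strict Implicit.
Unset Printing Implicit Defensive.

Local Open Scope classical_set_scope.
Local Open Scope ring_scope.

(* C(x, y, t, alpha0, alpha1) subject to 2 alpha0 + alpha1 = 1: alpha1 is
   eliminated, and the variables 0, 1, 2, 3 are x, y, t, alpha0. *)
Definition ratfun (R : realType) : fieldType := {fraction (mpoly 4 R[i])}.

Definition rvar (R : realType) (k : 'I_4) : ratfun R :=
  tofrac (mpolyX R[i] (mnm1 k)).

Definition rcst (R : realType) (c : R[i]) : ratfun R := tofrac (mpolyC 4 c).

Definition rx (R : realType) : ratfun R := rvar R 0.
Definition ry (R : realType) : ratfun R := rvar R 1.
Definition rt (R : realType) : ratfun R := rvar R 2.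
Definition ra0 (R : realType) : ratfun R := rvar R 3.
Definition ra1 (R : realType) : ratfun R := 1 - 2 * ra0 R.

Definition point (R : realType) (x y t a0 : R[i]) : 'I_4 -> R[i] :=
  fun k => [:: x; y; t; a0]`_k.

(* f is defined at v, with value c. The fraction need not be the given
   expression of f: y / y has value 1 at y = 0. *)
Definition has_value (R : realType) (f : ratfun R) (v : 'I_4 -> R[i])
    (c : R[i]) : Prop :=
  exists p q : mpoly 4 R[i],
    [/\ meval v q != 0, f = tofrac p / tofrac q & c = meval v p / meval v q].

(* Automorphisms of the field of rational functions over C. *)
Definition is_autom (R : realType) (s : ratfun R -> ratfun R) : Prop :=
  [/\ zmod_morphism s, monoid_morphism s,
      (forall c, s (rcst c) = rcst c) & bijective s].

(* f lies in the subfield C(alpha0) = C(alpha0, alpha1). *)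
Definition param_only (R : realType) (f : ratfun R) : Prop :=
  exists p q : {poly R[i]}, q != 0 /\
    f = (map_poly (@rcst R) p).[ra0 R] / (map_poly (@rcst R) q).[ra0 R].

(* R[i]^o is R[i] as a normed space over itself, so that is_derive t 1 is the
   complex derivative. The parameter alpha1 does not occur in the system. *)
Definition solution (R : realType) (a0 : R[i]) (D : set R[i]^o)
    (x y : R[i]^o -> R[i]^o) : Prop :=
  open D /\ forall t, D t ->
    is_derive t 1 x
      (x t ^+ 4 * y t + a0 * x t ^+ 3 + t / 2 * x t ^+ 2 + 1) /\
    is_derive t 1 y
      (- 2 * x t ^+ 3 * y t ^+ 2 - 3 * a0 * x t ^+ 2 * y t - t * x t * y t
       - a0 ^+ 2 * x t - a0 * t / 2).

(* The transformation (x, y, t; alpha) |-> (s x, s y, s t; s alpha).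
   The function theta is a local inverse of t |-> t', so that X and Y are x'
   and y' as functions of the new independent variable t'; when s t = t,
   theta is the identity of D'. The domain D' is any open set on which all
   the rational functions involved are defined. *)
Definition backlund (R : realType) (s : ratfun R -> ratfun R) : Prop :=
  [/\ is_autom s, param_only (s (ra0 R)) &
   forall (a0 : R[i]) (D : set R[i]^o) (x y : R[i]^o -> R[i]^o),
   solution a0 D x y ->
   forall (a0' : R[i]) (D' : set R[i]^o) (theta X Y : R[i]^o -> R[i]^o),
   open D' ->
   (forall t', D' t' ->
      let t := theta t' in
      let v := point (x t) (y t) t a0 in
      [/\ D t, derivable theta t' 1, has_value (s (rt R)) v t',
          has_value (s (ra0 R)) v a0' &
          has_value (s (rx R)) v (X t') /\ has_value (s (ry R)) v (Y t')]) ->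
   solution a0' D' X Y].

(* The group of bijections of T generated by s 0 and s 1. *)
Inductive generated (T : Type) (s : 'I_2 -> T -> T) : (T -> T) -> Prop :=
| gen_id : generated s id
| gen_gen i : generated s (s i)
| gen_comp f g : generated s f -> generated s g -> generated s (f \o g)
| gen_inv f g : generated s f -> cancel f g -> cancel g f -> generated s g.

(* The generalized Cartan matrix of type A_2^(2), with null root
   2 alpha_0 + alpha_1. *)
Definition cartan_A22 : 'M[int]_2 :=
  \matrix_(i, j) (if i == j then 2 else if i == 0 then - 4 else - 1).

(* r_i (alpha_j) = alpha_j - a_ij alpha_i on the root lattice
   Z alpha_0 + Z alpha_1, on which the affine Weyl group acts faithfully. *)
Definition simple_reflection (i : 'I_2) (v : 'cV[int]_2) : 'cV[int]_2 :=
  v - (cartan_A22 *m v) i 0 *: delta_mx i 0.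

Definition weyl_A22 : set ('cV[int]_2 -> 'cV[int]_2) :=
  generated simple_reflection.

Definition word_val (T : Type) (s : 'I_2 -> T -> T) (w : seq 'I_2) : T -> T :=
  foldr (fun i f => s i \o f) id w.

(* The congruence on words generated by i i ~ 1: its quotient is the group
   with the presentation < s_0, s_1 | s_0^2 = s_1^2 = 1 >. *)
Inductive dihedral_eq : seq 'I_2 -> seq 'I_2 -> Prop :=
| deq_cancel u i v : dihedral_eq (u ++ [:: i; i] ++ v) (u ++ v)
| deq_refl u : dihedral_eq u u
| deq_sym u v : dihedral_eq u v -> dihedral_eq v u
| deq_trans u v w : dihedral_eq u v -> dihedral_eq v w -> dihedral_eq u w.

(* The group generated by s 0 and s 1 is the affine Weyl group of type
   A_2^(2), with s 0 and s 1 as simple reflections. *)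
Definition is_weyl_A22 (T : Type) (s : 'I_2 -> T -> T) : Prop :=
  (exists phi : (T -> T) -> ('cV[int]_2 -> 'cV[int]_2),
     [/\ set_bij (generated s) weyl_A22 phi,
         (forall f g, generated s f -> generated s g ->
            phi (f \o g) = phi f \o phi g) &
         forall i, phi (s i) = simple_reflection i]) /\
  (forall w w', word_val s w = word_val s w' <-> dihedral_eq w w').

(* Main.v *)
(* The vector field of the system is a derivation of C(x, y, t, alpha0), and a
   field automorphism g fixing t and commuting with this derivation is a
   Baecklund transformation: along a solution, the derivative of g(x) is the
   value of g(x'), which is the vector field evaluated at (g(x), g(y)).
   Commuting with the derivation is preserved under composition, unlike the
   existence of the intermediate values, so this covers the whole group.

   The substitution s_i extends to the field because it is injective on
   polynomials: it is an involution of the polynomial ring localized at y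
   (for s_0) or at x (for s_1).

   Faithfulness is already visible on alpha0: a word acts by
   alpha0 |-> e alpha0 + n with e = 1 or -1 and n an integer, the same pair
   (e, n) describes its action on the root lattice, and it determines the word
   up to the relations i i = 1. *)
Require Import Defs.
From HB Require Import structures.
From mathcomp Require Import all_boot all_order all_algebra.
From mathcomp Require Import complex fraction generic_quotient ring.
From mathcomp Require Import all_classical all_reals all_analysis.
From mathcomp Require mpoly.
Import -(notations) mpoly.
Import numFieldNormedType.Exports.
Import Order.TTheory GRing.Theory Num.Theory.

Set Implicit Arguments.
Unset Strict Implicit.
Unset Printing Implicit Defensive.

Local Open Scope classical_set_scope.
Local Open Scope ring_scope.

(** * Case analysis on the indices of generators and variables *)

Lemma ord2_ind (P : 'I_2 -> Prop) : P 0 -> P 1 -> forall i, P i.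
Proof.
move=> P0 P1 [[|[|//]] lti].
  by rewrite (_ : Ordinal lti = 0) //; apply: val_inj.
by rewrite (_ : Ordinal lti = 1) //; apply: val_inj.
Qed.

Lemma ord4_ind (P : 'I_4 -> Prop) : P 0 -> P 1 -> P 2 -> P 3 -> forall k, P k.
Proof.
move=> P0 P1 P2 P3 [[|[|[|[|//]]]] ltk].
- by rewrite (_ : Ordinal ltk = 0) //; apply: val_inj.
- by rewrite (_ : Ordinal ltk = 1) //; apply: val_inj.
- by rewrite (_ : Ordinal ltk = 2) //; apply: val_inj.
- by rewrite (_ : Ordinal ltk = 3) //; apply: val_inj.
Qed.

(** * Words in the generators *)

Lemma dihedral_eq_cons i u v : dihedral_eq u v -> dihedral_eq (i :: u) (i :: v).
Proof.
elim=> [{}u j {}v | {}u | {}u {}v _ IH | {}u {}v w _ IHu _ IHv].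
- exact: (deq_cancel (i :: u)).
- exact: deq_refl.
- exact: deq_sym.
- exact: deq_trans IHu IHv.
Qed.

Lemma dihedral_eq_cancel2 i u : dihedral_eq u (i :: i :: u).
Proof. exact/deq_sym/(deq_cancel [::]). Qed.

(* The image of alpha0 under a word is (-1)^b alpha0 + n delta, where
   delta = 2 alpha0 + alpha1 is fixed, and (b, n) is the code of the word. *)
Fixpoint word_code (w : seq 'I_2) : bool * int :=
  if w is i :: w' then
    let: (b, n) := word_code w' in
    (~~ b, if i == 0 then n else n + (-1) ^+ b)
  else (false, 0).

(** The word of code [(false, n)]: the power n of [s_0 s_1], written with [s_1 s_0] when n is
    negative. [Negz m] is -(m+1), hence the extra iteration. *)
Definition translation (n : int) : seq 'I_2 :=
  match n with
  | Posz m => iter m (fun w => [:: 0, 1 & w]) [::]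
  | Negz m => iter m.+1 (fun w => [:: 1, 0 & w]) [::]
  end.

Definition normal_form (c : bool * int) : seq 'I_2 :=
  if c.1 then 0 :: translation c.2 else translation c.2.

Lemma translation_pred n :
  dihedral_eq [:: 1, 0 & translation n] (translation (n - 1)).
Proof.
case: n => [[|n]|n].
- exact: deq_refl.
- rewrite (_ : n.+1%:Z - 1 = n); last by rewrite intS addrC addKr.
  apply: deq_sym; apply: deq_trans (dihedral_eq_cancel2 1 _) _.
  exact/dihedral_eq_cons/dihedral_eq_cancel2.
- rewrite (_ : Negz n - 1 = Negz n.+1); first exact: deq_refl.
  by rewrite !NegzE (intS n.+1) opprD addrC.
Qed.

(** Prefixing a letter to a normal form gives, after cancellation, the normal form of the updated
    code. *)
Lemma normal_formP w : dihedral_eq w (normal_form (word_code w)).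
Proof.
elim: w => [|i w IH]; first exact: deq_refl.
apply: deq_trans (dihedral_eq_cons i IH) _ => /=.
case: (word_code w) => b n; elim/ord2_ind: i; case: b; rewrite /normal_form /=.
- exact/deq_sym/dihedral_eq_cancel2.
- exact: deq_refl.
- exact: translation_pred.
(* [translation n] is traded for 1, 0 followed by [translation (n + 1)], so that the new letter 1
   meets another 1. *)
- apply: deq_trans (_ : dihedral_eq _ [:: 1, 1, 0 & translation (n + 1)]) _.
    apply/dihedral_eq_cons/deq_sym.
    by have := translation_pred (n + 1); rewrite addrK.
  exact/deq_sym/dihedral_eq_cancel2.
Qed.

Lemma word_code_inj w w' : word_code w = word_code w' -> dihedral_eq w w'.
Proof.
move=> eq_code; apply: deq_trans (normal_formP w) _.
by rewrite eq_code; apply/deq_sym/normal_formP.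
Qed.

Section Words.
Variables (T : Type) (s : 'I_2 -> T -> T).
Hypothesis s_inv : forall i, involutive (s i).

Lemma word_val_cat u v : word_val s (u ++ v) = word_val s u \o word_val s v.
Proof. by elim: u => //= i u ->. Qed.

Lemma dihedral_eq_word_val w w' :
  dihedral_eq w w' -> word_val s w = word_val s w'.
Proof.
elim=> [u i v | u | u v _ -> | u v x _ -> _ ->] //.
rewrite !word_val_cat; congr (_ \o _); apply: funext => x /=.
by rewrite s_inv.
Qed.

Lemma word_val_rev w : cancel (word_val s w) (word_val s (rev w)).
Proof.
elim: w => [//|i w IH] x.
by rewrite rev_cons -cats1 word_val_cat /= s_inv IH.
Qed.

Lemma generated_word w : generated s (word_val s w).
Proof.
elim: w => [|i w IH]; first exact: gen_id.
exact: gen_comp (gen_gen s i) IH.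
Qed.

(** Words are closed under inverses because the generators are involutions: the reversed word is the
    inverse. *)
Lemma generatedP f : generated s f -> exists w, f = word_val s w.
Proof.
elim=> [|i|{}f g _ [u ->] _ [v ->]|{}f g _ [u ->] fK gK].
- by exists [::].
- by exists [:: i].
- by exists (u ++ v); rewrite word_val_cat.
- exists (rev u); apply: funext => x.
  by rewrite -{2}[x]gK word_val_rev.
Qed.

End Words.

(* If the image of a word under s, and under the simple reflections, both
   determine its code, then both groups have the presentation
   <s_0, s_1 | s_0^2 = s_1^2 = 1>. *)
Lemma is_weyl_A22_code (T : Type) (s : 'I_2 -> T -> T) :
  (forall i, involutive (s i)) ->
  (forall w w', word_val s w = word_val s w' -> word_code w = word_code w') ->
  (forall i, involutive (simple_reflection i)) ->
  (forall w w', word_val simple_reflection w = word_val simple_reflection w' ->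
     word_code w = word_code w') ->
  is_weyl_A22 s.
Proof.
move=> s_inv s_code r_inv r_code; split; last first.
  by move=> w w'; split=> [/s_code/word_code_inj|/dihedral_eq_word_val->].
(* [phi] evaluates a chosen word for f in the simple reflections; any two choices are congruent by
   [s_code]. Off the group the value [id] is arbitrary. *)
pose phi f := if pselect (exists w, f = word_val s w) is left e
  then word_val simple_reflection (projT1 (cid e)) else id.
have phiE w : phi (word_val s w) = word_val simple_reflection w.
  rewrite /phi; case: pselect => [e|[]]; last by exists w.
  case: cid => w' /= eq_w.
  exact/esym/dihedral_eq_word_val/word_code_inj/s_code.
exists phi; split; last 1 first.
- by move=> i; apply: (phiE [:: i]).
- split.
  + move=> f /generatedP-/(_ s_inv)[w ->] /=.
    by rewrite phiE; apply: generated_word.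
  + move=> f g /set_mem/generatedP-/(_ s_inv)[w ->].
    move=> /set_mem/generatedP-/(_ s_inv)[w' ->]; rewrite !phiE.
    by move=> /r_code/word_code_inj/dihedral_eq_word_val->.
  + move=> f /generatedP-/(_ r_inv)[w ->].
    by exists (word_val s w); [apply: generated_word|rewrite phiE].
- move=> f g /generatedP-/(_ s_inv)[u ->] /generatedP-/(_ s_inv)[v ->].
  by rewrite -word_val_cat !phiE word_val_cat.
Qed.

(** * Simple reflections on the root lattice *)

Lemma simple_reflectionE i v :
  simple_reflection i v = \col_j (if i == 0 then
      if j == 0 then - v 0 0 + 4 * v 1 0 else v 1 0
    else if j == 0 then v 0 0 else v 0 0 - v 1 0).
Proof.
apply/colP => j; rewrite !mxE big_ord_recl big_ord1 !mxE /=.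
rewrite (_ : lift ord0 ord0 = 1); last exact: val_inj.
by elim/ord2_ind: i; elim/ord2_ind: j => /=; ring.
Qed.

Lemma simple_reflectionK i : involutive (simple_reflection i).
Proof.
move=> v; rewrite !simple_reflectionE; apply/colP => j; rewrite !mxE /=.
by elim/ord2_ind: i; elim/ord2_ind: j => /=; ring.
Qed.

(** In the basis of simple roots the column is (-1)^b alpha_0 + n delta with delta = 2 alpha_0 +
    alpha_1. Both reflections fix delta, and r_1 sends alpha_0 to delta - alpha_0. *)
Lemma simple_reflection_word w :
  word_val simple_reflection w (delta_mx 0 0) =
  \col_j (if j == 0 then (-1) ^+ (word_code w).1 + 2 * (word_code w).2
          else (word_code w).2).
Proof.
elim: w => [|i w IH] /=.
  by apply/colP => j; rewrite !mxE; elim/ord2_ind: j.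
rewrite IH simple_reflectionE; apply/colP => j; rewrite !mxE.
case: (word_code w) => b n.
by elim/ord2_ind: i; elim/ord2_ind: j => /=; case: b => /=; ring.
Qed.

Lemma simple_reflection_code w w' :
  word_val simple_reflection w = word_val simple_reflection w' ->
  word_code w = word_code w'.
Proof.
move=> eq_w; have := simple_reflection_word w.
rewrite eq_w simple_reflection_word.
case: (word_code w) (word_code w') => [b n] [b' n'] /colP eq_c.
(* The coordinate on alpha_1 gives n; the other one then gives the sign. *)
have := eq_c 0; have := eq_c 1; rewrite !mxE /= => -> /addIr.
by case: b {eq_c}; case: b'.
Qed.

(** * Fraction fields and substitutions *)

(** The representative [repr f] supplies p and q; what remains is to compute the quotient of their
    embeddings on representatives. *)
Lemma fraction_tofrac (A : idomainType) (f : {fraction A}) :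
  exists p q : A, q != 0 /\ f = tofrac p / tofrac q.
Proof.
exists (fraction.frac (repr f)).1, (fraction.frac (repr f)).2.
have d0 := denom_ratioP (repr f); split => //.
rewrite -[LHS]reprK; unlock tofrac.
rewrite -[X in _ = _ * X]FracField.pi_inv -[RHS]FracField.pi_mul.
rewrite /FracField.mulf /FracField.invf.
rewrite !numden_Ratio ?oner_neq0 // mulr1 mul1r.
by rewrite Ratio_numden.
Qed.

(** Suited to morphisms and derivations, which are known on constants and variables and behave well
    under sums and products. *)
Lemma mpoly_gen_ind (n : nat) (A : comNzRingType) (P : mpoly n A -> Prop) :
  (forall c, P (mpolyC n c)) -> (forall i, P (mpolyX A (mnm1 i))) ->
  (forall p q, P p -> P q -> P (p + q)) ->
  (forall p q, P p -> P q -> P (p * q)) -> forall p, P p.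
Proof.
move=> PC PX PD PM; elim/mpolyind => [|c m p _ _ Pp].
  by rewrite -(mpolyC0 n A).
apply: PD => //; rewrite -mul_mpolyC; apply: (PM) => //.
rewrite mpolyXE_id.
elim/big_ind: _ => [||i _]; [by rewrite -mpolyC1|exact: PM|].
elim: (m i) => [|k IH]; first by rewrite expr0 -mpolyC1.
by rewrite exprS; apply: PM.
Qed.

Section FractionLift.
Variables (A : idomainType) (L : fieldType) (phi : {rmorphism A -> L}).
Hypothesis phi_inj : forall p, phi p = 0 -> p = 0.

(** Numerator and denominator are merely chosen; [fraction_liftE] shows by cross-multiplication that
    the choice does not matter. *)
Definition fraction_lift (f : {fraction A}) : L :=
  let: exist p pP := cid (fraction_tofrac f) in phi p / phi (projT1 (cid pP)).

Lemma fraction_liftE p q : q != 0 ->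
  fraction_lift (tofrac p / tofrac q) = phi p / phi q.
Proof.
have nz r : r != 0 -> phi r != 0 by apply: contra_neq => /phi_inj.
move=> q0; rewrite /fraction_lift; case: cid => p' pP.
case: cid => q' /= [q'0 /eqP].
rewrite eqr_div ?tofrac_eq0 // -!tofracM tofrac_eq => /eqP eq_pq.
by apply/esym/eqP; rewrite eqr_div ?nz // -!rmorphM eq_pq.
Qed.

Lemma fraction_lift_tofrac p : fraction_lift (tofrac p) = phi p.
Proof.
by rewrite -[tofrac p]divr1 -tofrac1 fraction_liftE ?oner_neq0 // rmorph1 divr1.
Qed.

Lemma fraction_lift_is_zmod_morphism : zmod_morphism fraction_lift.
Proof.
have nz r : r != 0 -> phi r != 0 by apply: contra_neq => /phi_inj.
move=> f g.
have [p [q [q0 ->]]] := fraction_tofrac f.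
have [p' [q' [q'0 ->]]] := fraction_tofrac g.
rewrite -mulNr addf_div ?tofrac_eq0 // -tofracN -!tofracM -tofracD.
rewrite !fraction_liftE ?mulf_neq0 // -mulNr addf_div ?nz //.
by rewrite rmorphD !rmorphM rmorphN.
Qed.

Lemma fraction_lift_is_monoid_morphism : monoid_morphism fraction_lift.
Proof.
split=> [|f g]; first by rewrite -tofrac1 fraction_lift_tofrac rmorph1.
have [p [q [q0 ->]]] := fraction_tofrac f.
have [p' [q' [q'0 ->]]] := fraction_tofrac g.
by rewrite mulf_div -!tofracM !fraction_liftE ?mulf_neq0 // !rmorphM mulf_div.
Qed.

End FractionLift.

Section RationalFunctions.
Variable R : realType.
Local Notation C := R[i].
Local Notation A := (mpoly 4 C).
Local Notation K := (ratfun R).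
Implicit Types (p q : A) (f g : K).

Lemma rcst_is_zmod_morphism : zmod_morphism (@rcst R).
Proof. by move=> a b; rewrite /rcst mpolyCB tofracB. Qed.

Lemma rcst_is_monoid_morphism : monoid_morphism (@rcst R).
Proof.
by split=> [|a b]; rewrite /rcst ?mpolyC1 ?tofrac1 // mpolyCM tofracM.
Qed.

HB.instance Definition _ :=
  GRing.isZmodMorphism.Build C K (@rcst R) rcst_is_zmod_morphism.
HB.instance Definition _ :=
  GRing.isMonoidMorphism.Build C K (@rcst R) rcst_is_monoid_morphism.

Lemma ratfun_ind (P : K -> Prop) :
  (forall c, P (rcst c)) -> (forall i, P (rvar R i)) ->
  (forall f g, P f -> P g -> P (f + g)) ->
  (forall f g, P f -> P g -> P (f * g)) ->
  (forall f, f != 0 -> P f -> P f^-1) -> forall f, P f.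
Proof.
move=> PC PX PD PM PV.
have PA p : P (tofrac p).
  elim/mpoly_gen_ind: p => [c|i|p q|p q]; [exact: PC|exact: PX| |].
    by rewrite tofracD; apply: PD.
  by rewrite tofracM; apply: PM.
move=> f; have [p [q [q0 ->]]] := fraction_tofrac f.
by apply: PM => //; apply: PV; rewrite ?tofrac_eq0.
Qed.

(** * Substitution of rational functions for the variables *)

Section Substitution.
Variable im : 'I_4 -> K.

Definition subst_poly : A -> K := mmap (@rcst R) im.

HB.instance Definition _ := GRing.RMorphism.on subst_poly.

Lemma subst_polyC c : subst_poly (mpolyC 4 c) = rcst c.
Proof. exact: mmapC. Qed.

Lemma subst_polyX i : subst_poly (mpolyX C (mnm1 i)) = im i.
Proof. by rewrite /subst_poly mmapX mmap1U. Qed.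

(* The hypothesis says that im, extended to A[1/d], is an involution. *)
Lemma subst_poly_inj (d : A) :
  d != 0 -> subst_poly d != 0 ->
  (forall i, exists n p, tofrac d ^+ n * im i = tofrac p /\
     subst_poly p = subst_poly d ^+ n * rvar R i) ->
  forall q, subst_poly q = 0 -> q = 0.
Proof.
move=> d0 phid0 imP q.
(* The property of the variables spreads to all q: a power of d clears the image of q to a
   polynomial p, and p is mapped back to q times a power of the image of d. A zero image thus forces
   p = 0, then q = 0. *)
have : exists n p, tofrac d ^+ n * subst_poly q = tofrac p /\
    subst_poly p = subst_poly d ^+ n * tofrac q.
  elim/mpoly_gen_ind: q => [c|i|q r [n [p [Eq Ep]]] [m [p' [Er Ep']]]|
      q r [n [p [Eq Ep]]] [m [p' [Er Ep']]]].
  - by exists 0%N, (mpolyC 4 c); rewrite !mul1r subst_polyC.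
  - by rewrite subst_polyX.
  - exists (n + m)%N, (d ^+ m * p + d ^+ n * p').
    rewrite !(rmorphD, rmorphM, rmorphXn) /= -Eq -Er Ep Ep' !exprD.
    by split; ring.
  - exists (n + m)%N, (p * p').
    rewrite !rmorphM /= -Eq -Er Ep Ep' !exprD.
    by split; ring.
move=> [n [p [Eq Ep]]] q0; apply/eqP; rewrite -tofrac_eq0.
move: Eq; rewrite q0 mulr0 => /esym/eqP; rewrite (tofrac_eq0 p) => /eqP p0.
move/esym/eqP: Ep; rewrite p0 rmorph0 mulf_eq0.
by rewrite (negPf (expf_neq0 _ phid0)).
Qed.
End Substitution.
End RationalFunctions.

(** * The derivation along the system *)

(** Additivity of the quotient rule, stated over an abstract field so that [field] sees plain
    variables; the next lemmas do the same for products and inverses. *)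
Lemma quotient_ruleD (L : fieldType) (p q p' q' dp dq dp' dq' : L) :
  q != 0 -> q' != 0 ->
  ((dp * q' + p * dq' + (dp' * q + p' * dq)) * (q * q')
    - (p * q' + p' * q) * (dq * q' + q * dq')) / (q * q') ^+ 2
  = (dp * q - p * dq) / q ^+ 2 + (dp' * q' - p' * dq') / q' ^+ 2.
Proof. by move=> q0 q'0; field; rewrite ?q0 ?q'0. Qed.

Lemma quotient_ruleM (L : fieldType) (p q p' q' dp dq dp' dq' : L) :
  q != 0 -> q' != 0 ->
  ((dp * p' + p * dp') * (q * q') - p * p' * (dq * q' + q * dq'))
    / (q * q') ^+ 2
  = (dp * q - p * dq) / q ^+ 2 * (p' / q')
    + p / q * ((dp' * q' - p' * dq') / q' ^+ 2).
Proof. by move=> q0 q'0; field; rewrite ?q0 ?q'0. Qed.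

Lemma quotient_ruleV (L : fieldType) (p q dp dq : L) :
  p != 0 -> q != 0 ->
  (dq * p - q * dp) / p ^+ 2
  = - ((dp * q - p * dq) / q ^+ 2 / (p / q) ^+ 2).
Proof. by move=> p0 q0; field; rewrite ?q0 ?p0. Qed.

Lemma quotient_ruleE (L : fieldType) (p q dp dq : L) : q != 0 ->
  p * (- q ^- 2 * dq) + q^-1 * dp = (dp * q - p * dq) / q ^+ 2.
Proof. by move=> q0; field. Qed.

(** * Extension of a derivation to the fraction field *)

Section FractionDerivation.
Variables (A : idomainType) (D : A -> A).
Hypothesis DD : forall p q, D (p + q) = D p + D q.
Hypothesis DM : forall p q, D (p * q) = D p * q + p * D q.

Definition fraction_deriv (f : {fraction A}) : {fraction A} :=
  let: exist p pP := cid (fraction_tofrac f) in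
  let q := projT1 (cid pP) in
  (tofrac (D p) * tofrac q - tofrac p * tofrac (D q)) / tofrac q ^+ 2.

Lemma fraction_derivE p q : q != 0 ->
  fraction_deriv (tofrac p / tofrac q) =
  (tofrac (D p) * tofrac q - tofrac p * tofrac (D q)) / tofrac q ^+ 2.
Proof.
move=> q0; rewrite /fraction_deriv; case: cid => p' pP.
case: cid => q' /= [q'0 /eqP].
rewrite eqr_div ?tofrac_eq0 // -!tofracM tofrac_eq => /eqP eq_pq.
have eq_D : D p * q' + p * D q' = D p' * q + p' * D q by rewrite -!DM eq_pq.
apply/esym/eqP; rewrite eqr_div ?expf_neq0 ?tofrac_eq0 //.
rewrite -!(tofracM, tofracB, tofracXn) tofrac_eq -subr_eq0; apply/eqP.
(* The difference of the two cross products is a combination of the relation p q' = p' q and of its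
   derivative. *)
transitivity (q * q' * (D p * q' + p * D q' - (D p' * q + p' * D q))
  - (p * q' - p' * q) * (q * D q' + q' * D q)); first by ring.
by rewrite eq_D eq_pq !subrr mulr0 mul0r subrr.
Qed.

Lemma fraction_deriv_tofrac p : fraction_deriv (tofrac p) = tofrac (D p).
Proof.
have D1 : D 1 = 0.
  by apply: (addrI (D 1)); rewrite addr0 -{3}(mulr1 1) DM mulr1 mul1r.
rewrite -[tofrac p]divr1 -tofrac1 fraction_derivE ?oner_neq0 // D1 tofrac0.
by rewrite mulr0 subr0 tofrac1 mulr1 expr1n divr1.
Qed.

Lemma fraction_derivD f g :
  fraction_deriv (f + g) = fraction_deriv f + fraction_deriv g.
Proof.
have [p [q [q0 ->]]] := fraction_tofrac f.
have [p' [q' [q'0 ->]]] := fraction_tofrac g.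
rewrite addf_div ?tofrac_eq0 // -!tofracM -tofracD.
rewrite !fraction_derivE ?mulf_neq0 // !(DD, DM, tofracD, tofracM).
by apply: quotient_ruleD; rewrite tofrac_eq0.
Qed.

Lemma fraction_derivM f g :
  fraction_deriv (f * g) = fraction_deriv f * g + f * fraction_deriv g.
Proof.
have [p [q [q0 ->]]] := fraction_tofrac f.
have [p' [q' [q'0 ->]]] := fraction_tofrac g.
rewrite mulf_div -!tofracM.
rewrite !fraction_derivE ?mulf_neq0 // !(DD, DM, tofracD, tofracM).
by apply: quotient_ruleM; rewrite tofrac_eq0.
Qed.

Lemma fraction_derivV f : f != 0 ->
  fraction_deriv f^-1 = - (fraction_deriv f / f ^+ 2).
Proof.
have [p [q [q0 ->]]] := fraction_tofrac f.
rewrite mulf_eq0 invr_eq0 !tofrac_eq0 (negPf q0) orbF => p0.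
rewrite invf_div !fraction_derivE //.
by apply: quotient_ruleV; rewrite tofrac_eq0.
Qed.

End FractionDerivation.

(** The argument [h] stands for 1/2. The formula then makes sense in any ring and is carried along
    by every ring morphism, so it serves for polynomials, rational functions and values alike. *)
Definition flow_x (L : pzRingType) (h x y t a : L) : L :=
  x ^+ 4 * y + a * x ^+ 3 + t * h * x ^+ 2 + 1.

Definition flow_y (L : pzRingType) (h x y t a : L) : L :=
  - 2 * x ^+ 3 * y ^+ 2 - 3 * a * x ^+ 2 * y - t * x * y - a ^+ 2 * x
  - a * t * h.

Lemma rmorph_flow_x (L M : pzRingType) (g : {rmorphism L -> M}) h x y t a :
  g (flow_x h x y t a) = flow_x (g h) (g x) (g y) (g t) (g a).
Proof. by rewrite /flow_x !(rmorphD, rmorphM, rmorphXn) rmorph1. Qed.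

Lemma rmorph_flow_y (L M : pzRingType) (g : {rmorphism L -> M}) h x y t a :
  g (flow_y h x y t a) = flow_y (g h) (g x) (g y) (g t) (g a).
Proof.
by rewrite /flow_y !(rmorphB, rmorphM, rmorphXn, rmorphN) !rmorph_nat.
Qed.

Section Flow.
Variable R : realType.
Local Notation C := R[i].
Local Notation A := (mpoly 4 C).
Local Notation K := (ratfun R).
Implicit Types (p q : A) (f g : K).

Let X (i : 'I_4) : A := mpolyX C (mnm1 i).
Let h : A := mpolyC 4 2^-1.

(* The derivative along the solutions of the system. *)
Definition poly_flow p : A :=
  mderiv 2 p + flow_x h (X 0) (X 1) (X 2) (X 3) * mderiv 0 p
  + flow_y h (X 0) (X 1) (X 2) (X 3) * mderiv 1 p.

Lemma poly_flowD p q : poly_flow (p + q) = poly_flow p + poly_flow q.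
Proof. by rewrite /poly_flow !mderivD; ring. Qed.

Lemma poly_flowM p q :
  poly_flow (p * q) = poly_flow p * q + p * poly_flow q.
Proof. by rewrite /poly_flow !mderivM; ring. Qed.

Lemma poly_flowC c : poly_flow (mpolyC 4 c) = 0.
Proof. by rewrite /poly_flow !mderivC !mulr0 !addr0. Qed.

Lemma mderiv_var (i j : 'I_4) : mderiv i (X j) = (i == j)%:R.
Proof.
rewrite mderivX mnm1E eq_sym; case: eqP => [->|_]; last by rewrite scale0r.
by rewrite scale1r -{1}(add0m (mnm1 j)) addmK mpolyX0.
Qed.

Definition ratfun_flow : K -> K := fraction_deriv poly_flow.

Lemma ratfun_flowD f g : ratfun_flow (f + g) = ratfun_flow f + ratfun_flow g.
Proof. exact: fraction_derivD poly_flowD poly_flowM _ _. Qed.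

Lemma ratfun_flowM f g :
  ratfun_flow (f * g) = ratfun_flow f * g + f * ratfun_flow g.
Proof. exact: fraction_derivM poly_flowM _ _. Qed.

Lemma ratfun_flowV f : f != 0 -> ratfun_flow f^-1 = - (ratfun_flow f / f ^+ 2).
Proof. exact: fraction_derivV poly_flowM _. Qed.

Lemma ratfun_flow_cst c : ratfun_flow (rcst c) = 0.
Proof.
rewrite /ratfun_flow (fraction_deriv_tofrac poly_flowM) poly_flowC.
exact: tofrac0.
Qed.

Lemma rcst_half : rcst 2^-1 = 2^-1 :> K.
Proof. by rewrite fmorphV rmorph_nat. Qed.

Lemma ratfun_flow_var : [/\
  ratfun_flow (rx R) = flow_x 2^-1 (rx R) (ry R) (rt R) (ra0 R),
  ratfun_flow (ry R) = flow_y 2^-1 (rx R) (ry R) (rt R) (ra0 R),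
  ratfun_flow (rt R) = 1 & ratfun_flow (ra0 R) = 0].
Proof.
rewrite /ratfun_flow /rx /ry /rt /ra0 /rvar -rcst_half.
rewrite !(fraction_deriv_tofrac poly_flowM) /poly_flow !mderiv_var /=.
rewrite !(mulr0, mulr1, addr0, add0r) rmorph_flow_x rmorph_flow_y.
by rewrite tofrac0 tofrac1.
Qed.

End Flow.

(** * Values along a solution *)

Section Values.
Variable R : realType.
Local Notation C := R[i].
Local Notation A := (mpoly 4 C).
Local Notation K := (ratfun R).
Implicit Types (p q : A) (f g : K) (v : 'I_4 -> C).

(** Two fractions for f satisfy a cross-multiplied polynomial identity, which can be evaluated at
    v. *)
Lemma has_value_uniq f v c c' : has_value f v c -> has_value f v c' -> c = c'.
Proof.
move=> [p [q [q0 -> ->]]] [p' [q' [q'0 /eqP eq_f ->]]].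
have nz r : meval v r != 0 -> r != 0.
  by apply: contra_neq => ->; rewrite meval0.
move: eq_f; rewrite eqr_div ?tofrac_eq0 ?nz // -!tofracM tofrac_eq => /eqP eq_f.
by apply/eqP; rewrite eqr_div // -!mevalM eq_f.
Qed.

Lemma has_value_tofrac p v : has_value (tofrac p) v (meval v p).
Proof.
by exists p, 1; rewrite meval1 oner_neq0 tofrac1 !divr1.
Qed.

Lemma has_value_cst c v : has_value (rcst c) v c.
Proof. by have := has_value_tofrac (mpolyC 4 c) v; rewrite mevalC. Qed.

Lemma has_value_var i v : has_value (rvar R i) v (v i).
Proof.
by have := has_value_tofrac (mpolyX C (mnm1 i)) v; rewrite mevalXU.
Qed.

Lemma has_valueD f g v c d :
  has_value f v c -> has_value g v d -> has_value (f + g) v (c + d).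
Proof.
move=> [p [q [q0 -> ->]]] [p' [q' [q'0 -> ->]]].
exists (p * q' + p' * q), (q * q'); rewrite !(mevalM, mevalD) mulf_neq0 //.
have nz r : meval v r != 0 -> tofrac r != 0.
  by rewrite tofrac_eq0; apply: contra_neq => ->; rewrite meval0.
by rewrite !(tofracM, tofracD) !addf_div ?nz.
Qed.

Lemma has_valueM f g v c d :
  has_value f v c -> has_value g v d -> has_value (f * g) v (c * d).
Proof.
move=> [p [q [q0 -> ->]]] [p' [q' [q'0 -> ->]]].
exists (p * p'), (q * q'); rewrite !mevalM mulf_neq0 //.
by rewrite !tofracM !mulf_div.
Qed.

Lemma has_valueX f v c n : has_value f v c -> has_value (f ^+ n) v (c ^+ n).
Proof.
move=> fc; elim: n => [|n IH]; last by rewrite !exprS; apply: has_valueM.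
by rewrite !expr0 -(rmorph1 (@rcst R)); apply: has_value_cst.
Qed.

Lemma has_valueN f v c : has_value f v c -> has_value (- f) v (- c).
Proof.
move=> fc; rewrite -mulN1r -[X in has_value _ _ X]mulN1r.
apply: has_valueM => //; rewrite -(rmorphN1 (@rcst R)).
exact: has_value_cst.
Qed.

Lemma has_value_nat n v : has_value n%:R v n%:R.
Proof. by rewrite -(rmorph_nat (@rcst R)); apply: has_value_cst. Qed.

Lemma has_value_flow_x x y t a v cx cy ct ca :
  has_value x v cx -> has_value y v cy -> has_value t v ct ->
  has_value a v ca ->
  has_value (flow_x 2^-1 x y t a) v (flow_x 2^-1 cx cy ct ca).
Proof.
move=> vx vy vt va; rewrite -rcst_half.
have vh := has_value_cst 2^-1 v; have v1 := has_value_nat 1 v.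
by do ![assumption | apply: has_valueD | apply: has_valueM | apply: has_valueX].
Qed.

Lemma has_value_flow_y x y t a v cx cy ct ca :
  has_value x v cx -> has_value y v cy -> has_value t v ct ->
  has_value a v ca ->
  has_value (flow_y 2^-1 x y t a) v (flow_y 2^-1 cx cy ct ca).
Proof.
move=> vx vy vt va; rewrite -rcst_half.
have vh := has_value_cst 2^-1 v; have v2 := has_value_nat 2 v.
have v3 := has_value_nat 3 v.
by do ![assumption | apply: has_valueD | apply: has_valueN | apply: has_valueM
  | apply: has_valueX].
Qed.

(** The vector field in the coordinates x, y, t, alpha0: time has unit speed and the parameter is
    constant. *)
Lemma meval_poly_flow_var (i : 'I_4) (x y t a : C) :
  meval (Defs.point x y t a) (poly_flow (mpolyX C (mnm1 i))) =
  Defs.point (flow_x 2^-1 x y t a) (flow_y 2^-1 x y t a) 1 0 i.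
Proof.
set v := Defs.point x y t a.
rewrite /poly_flow !mevalD !mevalM.
rewrite (rmorph_flow_x (meval v)) (rmorph_flow_y (meval v)) /=.
rewrite !mevalXU !mevalC !mderiv_var !rmorph_nat.
by case: i => [[|[|[|[|//]]]] lti]; rewrite /v /Defs.point /=; ring.
Qed.

Section AlongSolution.
Variables (a0 : C) (D : set C^o) (x y : C^o -> C^o).
Hypothesis xy_sol : solution a0 D x y.

Let v (t : C^o) := Defs.point (x t) (y t) t a0.

(** Both sides obey the sum and product rules, so it suffices to compare them on constants and
    variables, where the system itself gives the derivatives. *)
Lemma is_derive_poly_flow p (t : C^o) : D t ->
  is_derive t 1 (fun t => meval (v t) p : C^o) (meval (v t) (poly_flow p)).
Proof.
move=> Dt; have [dx dy] := xy_sol.2 t Dt.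
elim/mpoly_gen_ind: p => [c|i|p q dp dq|p q dp dq].
- rewrite poly_flowC meval0 (_ : (fun _ => _) = cst c).
    exact: is_derive_cst.
  by apply/funext => t'; rewrite mevalC.
- rewrite (_ : (fun _ => _) = fun t' => v t' i); last first.
    by apply/funext => t'; rewrite mevalXU.
  rewrite meval_poly_flow_var.
  case: i => [[|[|[|[|//]]]] lti]; rewrite /v /Defs.point /=.
  + apply: is_derive_eq dx _; rewrite /flow_x; ring.
  + apply: is_derive_eq dy _; rewrite /flow_y; ring.
  + apply: is_derive_eq (is_derive_id _ _) _; ring.
  + apply: is_derive_eq (is_derive_cst _ _ _) _; ring.
- rewrite poly_flowD mevalD.
  rewrite (_ : (fun _ => _) = (fun t => meval (v t) p : C^o)
    + (fun t => meval (v t) q : C^o)); last first.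
    by apply/funext => t'; rewrite mevalD.
  exact: is_deriveD dp dq.
- rewrite poly_flowM mevalD !mevalM.
  rewrite (_ : (fun _ => _) = (fun t => meval (v t) p : C^o)
    * (fun t => meval (v t) q : C^o)); last first.
    by apply/funext => t'; rewrite mevalM.
  apply: is_derive_eq (is_deriveM dp dq) _.
  by rewrite addrC /GRing.scale /= mulrC.
Qed.

(** The fraction giving the value of f may vary with the point. The one valid at t stays valid
    nearby, since its denominator is continuous, and uniqueness of values identifies it there with
    X. *)
Lemma is_derive_ratfun_flow f (D' : set C^o) (X : C^o -> C^o) (t c : C^o) :
  open D' -> D' `<=` D -> (forall t', D' t' -> has_value f (v t') (X t')) ->
  D' t -> has_value (ratfun_flow f) (v t) c -> is_derive t 1 X c.
Proof.
move=> oD' sD' fX D't fc; have [p [q [q0 Ef EX]]] := fX t D't.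
have [dp dq] : is_derive t 1 (fun t => meval (v t) p : C^o)
    (meval (v t) (poly_flow p)) /\ is_derive t 1 (fun t => meval (v t) q : C^o)
    (meval (v t) (poly_flow q)).
  by split; apply: is_derive_poly_flow; apply: sD'.
have nz : q != 0 by apply: contra_neq q0 => ->; rewrite meval0.
have -> : c = (meval (v t) (poly_flow p) * meval (v t) q
    - meval (v t) p * meval (v t) (poly_flow q)) / meval (v t) q ^+ 2.
  apply: has_value_uniq fc _.
  rewrite Ef /ratfun_flow (fraction_derivE (@poly_flowM R)) //.
  exists (poly_flow p * q - p * poly_flow q), (q ^+ 2).
  rewrite !(mevalB, mevalM, rmorphXn) /= mulf_neq0 //.
  by rewrite !(tofracB, tofracM, tofracXn).
have dV : is_derive t 1 (fun t => (meval (v t) q)^-1 : C^o)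
    (- meval (v t) q ^- 2 *: meval (v t) (poly_flow q)).
  have [dq1 dq2] := dq; split; first exact: derivableV.
  by rewrite deriveV // dq2.
have dpq := is_deriveM dp dV.
have {dpq} : is_derive t 1 (fun t => meval (v t) p / meval (v t) q : C^o)
  ((meval (v t) (poly_flow p) * meval (v t) q
    - meval (v t) p * meval (v t) (poly_flow q)) / meval (v t) q ^+ 2).
  by apply: is_derive_eq dpq _; rewrite /GRing.scale /=; apply: quotient_ruleE.
apply: near_eq_is_derive.
have qc : {for t, continuous (fun t => meval (v t) q : C^o)}.
  by apply/differentiable_continuous/derivable1_diffP; case: dq.
have near_q : \forall t' \near t, meval (v t') q != 0.
  exact: (cvgr_neq0 _ qc).
near=> t'.
have D't' : D' t' by near: t'; exact: open_nbhs_nbhs.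
apply: has_value_uniq (fX t' D't').
exists p, q; split => //; by near: t'.
Unshelve. all: by end_near. Qed.

End AlongSolution.

Lemma backlund_flow (g : K -> K) (e : C) (c : C) :
  is_autom g -> g (rt R) = rt R -> g (ra0 R) = rcst e * ra0 R + rcst c ->
  (forall f, g (ratfun_flow f) = ratfun_flow (g f)) -> backlund g.
Proof.
move=> g_aut gt ga gflow; split => //.
  (* The new parameter is an affine polynomial in alpha0. *)
  exists (e *: 'X + c%:P), 1; rewrite oner_neq0; split => //.
  rewrite rmorph1 hornerC divr1 rmorphD /= map_polyZ map_polyX map_polyC.
  by rewrite !hornerE.
case: (g_aut) => gB gM gC _.
pose gR : {rmorphism K -> K} := HB.pack g
  (GRing.isZmodMorphism.Build K K g gB)
  (GRing.isMonoidMorphism.Build K K g gM).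
move=> a0 D x y xy_sol a0' D' theta X Y oD' D'P; split => // t D't.
(* As g fixes t, the reparametrization is the identity on [D']. *)
have vt t' : D' t' -> theta t' = t'.
  move=> /D'P[_ _]; rewrite gt => tv _ _; apply: has_value_uniq tv.
  exact: has_value_var.
have D'D : D' `<=` D.
  by move=> t' D't'; have := D'P _ D't'; rewrite vt // => -[].
have D'v t' : D' t' -> let v := Defs.point (x t') (y t') t' a0 in
    [/\ has_value (g (rt R)) v t', has_value (g (ra0 R)) v a0',
    has_value (g (rx R)) v (X t') & has_value (g (ry R)) v (Y t')].
  by move=> D't'; have := D'P _ D't'; rewrite vt // => -[_ _ ? ? []].
have [vT va vX vY] := D'v t D't.
have [fx fy _ _] := ratfun_flow_var R.
have gh : gR 2^-1 = 2^-1 by rewrite fmorphV rmorph_nat.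
split.
- apply: (is_derive_ratfun_flow xy_sol (f := g (rx R)) oD') => //.
    by move=> t' /D'v[].
  (* Commutation turns the derivative of g(x) into the vector field evaluated at the images of the
     variables. *)
  rewrite -gflow fx -[g _]/(gR _) rmorph_flow_x gh.
  exact: has_value_flow_x.
- apply: (is_derive_ratfun_flow xy_sol (f := g (ry R)) oD') => //.
    by move=> t' /D'v[].
  rewrite -gflow fy -[g _]/(gR _) rmorph_flow_y gh.
  exact: has_value_flow_y.
Qed.

End Values.

(** * The generators *)

Section WeylAction.
Variable R : realType.
Local Notation C := R[i].
Local Notation A := (mpoly 4 C).
Local Notation K := (ratfun R).
Implicit Types (p q : A) (f g : K).

Let x := rx R.
Let y := ry R.
Let t := rt R.
Let a0 := ra0 R.

(** Images of x, y, t, alpha0 in this order. With alpha1 = 1 - 2 alpha0 eliminated, alpha0 + alpha1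
    becomes 1 - alpha0. *)
Definition weyl_im (i : 'I_2) : 'I_4 -> K := fun k =>
  (if i == 0 then [:: x + a0 / y; y; t; - a0]
   else [:: - x; - y + (1 - 2 * a0) / x - t / x ^+ 2 - 2 / x ^+ 4; t;
            1 - a0])`_k.

Definition weyl (i : 'I_2) : K -> K :=
  @fraction_lift A K (subst_poly (weyl_im i)).

Lemma rvar_neq0 k : rvar R k != 0.
Proof.
rewrite tofrac_eq0; apply/eqP => /(congr1 (meval (fun=> 1))).
by rewrite mevalXU meval0 => /eqP; rewrite oner_eq0.
Qed.

Lemma weyl_im0_inv (L : fieldType) (u v a : L) : v != 0 ->
  v * (u + a / v) = u * v + a /\ (u + a / v) * v - a = v * u.
Proof. by move=> v0; split; field. Qed.

(** The image of y under s_1, multiplied by x^4 to clear its pole. *)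
Definition weyl_num (L : pzRingType) (u v s a : L) : L :=
  - u ^+ 4 * v + (1 - 2 * a) * u ^+ 3 - s * u ^+ 2 - 2.

Lemma rmorph_weyl_num (L M : pzRingType) (g : {rmorphism L -> M}) u v s a :
  g (weyl_num u v s a) = weyl_num (g u) (g v) (g s) (g a).
Proof.
rewrite /weyl_num 2!rmorphB rmorphD !(rmorphB, rmorphM, rmorphN, rmorphXn).
by rewrite rmorph1 !rmorph_nat.
Qed.

Lemma weyl_im1_inv (L : fieldType) (u v s a : L) : u != 0 ->
  let w := - v + (1 - 2 * a) / u - s / u ^+ 2 - 2 / u ^+ 4 in
  u ^+ 4 * w = weyl_num u v s a /\
  weyl_num (- u) w s (1 - a) = (- u) ^+ 4 * v.
Proof. by move=> u0 w; rewrite /w /weyl_num; split; field. Qed.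

Lemma weyl_im1_K (L : fieldType) (u v s a : L) : u != 0 ->
  - (- v + (1 - 2 * a) / u - s / u ^+ 2 - 2 / u ^+ 4)
    + (1 - 2 * (1 - a)) / - u - s / (- u) ^+ 2 - 2 / (- u) ^+ 4 = v.
Proof. by move=> u0; field; rewrite oppr_eq0 u0. Qed.

Lemma weyl_poly_inj i q : subst_poly (weyl_im i) q = 0 -> q = 0.
Proof.
pose X (k : 'I_4) : A := mpolyX C (mnm1 k).
have X0 k : X k != 0 by have := rvar_neq0 k; rewrite tofrac_eq0.
elim/ord2_ind: i;
  (* The element to invert is y for s_0 and x for s_1; below, only the images of x under s_0 (one
     factor y) and of y under s_1 (four factors x) have denominators to clear. *)
  [apply: (subst_poly_inj (X0 1)) | apply: (subst_poly_inj (X0 0))].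
- by rewrite subst_polyX; apply: rvar_neq0.
- elim/ord4_ind.
  + exists 1%N, (X 0 * X 1 + X 3).
    rewrite tofracD tofracM rmorphD rmorphM /= !subst_polyX !expr1.
    exact: weyl_im0_inv (rvar_neq0 1).
  + by exists 0%N, (X 1); rewrite !mul1r subst_polyX.
  + by exists 0%N, (X 2); rewrite !mul1r subst_polyX.
  + by exists 0%N, (- X 3); rewrite !mul1r tofracN rmorphN /= subst_polyX opprK.
- by rewrite subst_polyX oppr_eq0; apply: rvar_neq0.
- elim/ord4_ind.
  + by exists 0%N, (- X 0); rewrite !mul1r tofracN rmorphN /= subst_polyX opprK.
  + exists 4%N, (weyl_num (X 0) (X 1) (X 2) (X 3)).
    rewrite (rmorph_weyl_num (@tofrac A)) (rmorph_weyl_num (subst_poly _)).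
    rewrite /= !subst_polyX.
    exact: weyl_im1_inv (rvar_neq0 0).
  + by exists 0%N, (X 2); rewrite !mul1r subst_polyX.
  + exists 0%N, (1 - X 3); rewrite !mul1r tofracB tofrac1 rmorphB rmorph1 /=.
    by rewrite subst_polyX opprB addrCA subrr addr0.
Qed.

HB.instance Definition _ i := GRing.isZmodMorphism.Build K K (weyl i)
  (fraction_lift_is_zmod_morphism (@weyl_poly_inj i)).
HB.instance Definition _ i := GRing.isMonoidMorphism.Build K K (weyl i)
  (fraction_lift_is_monoid_morphism (@weyl_poly_inj i)).

Lemma weyl_cst i c : weyl i (rcst c) = rcst c.
Proof.
by rewrite /weyl (fraction_lift_tofrac (@weyl_poly_inj i)) /= subst_polyC.
Qed.

Lemma weyl_var i k : weyl i (rvar R k) = weyl_im i k.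
Proof.
by rewrite /weyl (fraction_lift_tofrac (@weyl_poly_inj i)) /= subst_polyX.
Qed.

Lemma weylE0 : [/\ weyl 0 x = x + a0 / y, weyl 0 y = y, weyl 0 t = t &
  weyl 0 a0 = - a0].
Proof. by split; rewrite weyl_var. Qed.

Lemma weylE1 : [/\ weyl 1 x = - x,
  weyl 1 y = - y + (1 - 2 * a0) / x - t / x ^+ 2 - 2 / x ^+ 4,
  weyl 1 t = t & weyl 1 a0 = 1 - a0].
Proof. by split; rewrite weyl_var. Qed.

Lemma weylK i : involutive (weyl i).
Proof.
elim/ratfun_ind => [c|k|f g Ef Eg|f g Ef Eg|f _ Ef].
- by rewrite !weyl_cst.
- have [x0 xy0 xt0 xa0] := weylE0; have [x1 xy1 xt1 xa1] := weylE1.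
  elim/ord2_ind: i; elim/ord4_ind: k.
  + rewrite -/(rx R) x0 rmorphD /= fmorph_div /= x0 xy0 xa0.
    by rewrite mulNr addrK.
  + by rewrite !xy0.
  + by rewrite !xt0.
  + by rewrite xa0 rmorphN /= xa0 opprK.
  + by rewrite x1 rmorphN /= x1 opprK.
  + rewrite xy1 2!rmorphB rmorphD rmorphN /= !fmorph_div /= !rmorphXn /=.
    rewrite rmorphB rmorphM rmorph1 !rmorph_nat /= x1 xy1 xt1 xa1.
    exact: weyl_im1_K (rvar_neq0 0).
  + by rewrite !xt1.
  + by rewrite xa1 rmorphB rmorph1 /= xa1 opprB addrCA subrr addr0.
- by rewrite !rmorphD /= Ef Eg.
- by rewrite !rmorphM /= Ef Eg.
- by rewrite !fmorphV /= Ef.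
Qed.

(** * Commutation of the generators with the derivation *)

Lemma ratfun_flowN f : ratfun_flow (- f) = - ratfun_flow f.
Proof.
rewrite -mulN1r -[LHS]addr0 ratfun_flowM -(rmorphN1 (@rcst R)).
by rewrite ratfun_flow_cst mul0r add0r addr0 rmorphN1 mulN1r.
Qed.

Lemma ratfun_flow_nat n : ratfun_flow (n%:R : K) = 0.
Proof. by rewrite -(rmorph_nat (@rcst R)) ratfun_flow_cst. Qed.

Lemma ratfun_flow_div f g : g != 0 ->
  ratfun_flow (f / g) =
  ratfun_flow f / g - f * (ratfun_flow g / g ^+ 2).
Proof. by move=> g0; rewrite ratfun_flowM ratfun_flowV // mulrN. Qed.

Lemma ratfun_flowXn f n :
  ratfun_flow (f ^+ n) = n%:R * f ^+ n.-1 * ratfun_flow f.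
Proof.
have ruleS (L : comNzRingType) (m u d : L) k :
    d * u ^+ k.+1 + u * (m * u ^+ k * d) = (m + 1) * u ^+ k.+1 * d.
  by rewrite exprS; ring.
elim: n => [|[|n] IH]; first by rewrite expr0 (ratfun_flow_nat 1) !mul0r.
  by rewrite expr1 expr0 !mul1r.
by rewrite exprS ratfun_flowM IH -[n.+2%:R]natr1; apply: ruleS.
Qed.

(** On the left is the vector field at the transformed point, on the right the derivative of the
    transformed coordinates, left in the shape the derivation rules produce: the 0 is the derivative
    of alpha0. The next lemma has the same form. *)
Lemma weyl_flow0 (L : fieldType) (u v s a : L) :
  v != 0 -> 2 != 0 :> L ->
  let F := flow_x 2^-1 u v s a in let G := flow_y 2^-1 u v s a in
  flow_x 2^-1 (u + a / v) v s (- a) = F + (0 / v - a * (G / v ^+ 2)) /\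
  flow_y 2^-1 (u + a / v) v s (- a) = G.
Proof.
move=> v0 two0; rewrite /flow_x /flow_y.
by split; field; rewrite ?two0 ?v0.
Qed.

Lemma weyl_flow1 (L : fieldType) (u v s a : L) :
  u != 0 -> 2 != 0 :> L ->
  let F := flow_x 2^-1 u v s a in let G := flow_y 2^-1 u v s a in
  let w := - v + (1 - 2 * a) / u - s / u ^+ 2 - 2 / u ^+ 4 in
  flow_x 2^-1 (- u) w s (1 - a) = - F /\
  flow_y 2^-1 (- u) w s (1 - a) =
    - G + ((0 - (0 * a + 2 * 0)) / u - (1 - 2 * a) * (F / u ^+ 2))
    - (1 / u ^+ 2 - s * (2 * u ^+ 1 * F / (u ^+ 2) ^+ 2))
    - (0 / u ^+ 4 - 2 * (4 * u ^+ 3 * F / (u ^+ 4) ^+ 2)).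
Proof.
move=> u0 two0 F G w; rewrite /F /G /w /flow_x /flow_y.
by split; field; rewrite ?two0 ?u0.
Qed.

(** Both sides are derivations along the morphism [weyl i], so agreement on constants and on the
    four variables is enough. *)
Lemma weyl_flow i f : weyl i (ratfun_flow f) = ratfun_flow (weyl i f).
Proof.
have [x0 xy0 xt0 xa0] := weylE0; have [x1 xy1 xt1 xa1] := weylE1.
have [fx fy ft fa] := ratfun_flow_var R.
have two0 : 2 != 0 :> K.
  by rewrite -(rmorph_nat (@rcst R)) fmorph_eq0 pnatr_eq0.
have wh j : weyl j 2^-1 = 2^-1 by rewrite fmorphV rmorph_nat.
elim/ratfun_ind: f => [c|k|f g Ef Eg|f g Ef Eg|f f0 Ef].
- by rewrite weyl_cst ratfun_flow_cst rmorph0.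
- elim/ord2_ind: i; elim/ord4_ind: k.
  + rewrite -/(rx R) fx (rmorph_flow_x (weyl 0)) /= x0 xy0 xt0 xa0 wh.
    rewrite ratfun_flowD (ratfun_flow_div _ (rvar_neq0 1)) fx fy fa.
    exact: (weyl_flow0 _ _ _ (rvar_neq0 1) two0).1.
  + rewrite -/(ry R) fy (rmorph_flow_y (weyl 0)) /= x0 xy0 xt0 xa0 wh fy.
    exact: (weyl_flow0 _ _ _ (rvar_neq0 1) two0).2.
  + by rewrite -/(rt R) ft rmorph1 xt0 ft.
  + by rewrite -/(ra0 R) fa rmorph0 xa0 ratfun_flowN fa oppr0.
  + rewrite -/(rx R) fx (rmorph_flow_x (weyl 1)) /= x1 xy1 xt1 xa1 wh.
    rewrite ratfun_flowN fx.
    exact: (weyl_flow1 _ _ _ (rvar_neq0 0) two0).1.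
  + rewrite -/(ry R) fy (rmorph_flow_y (weyl 1)) /= x1 xy1 xt1 xa1 wh.
    rewrite !(ratfun_flowD, ratfun_flowN).
    rewrite !ratfun_flow_div ?expf_neq0 ?(rvar_neq0 0) //.
    rewrite !ratfun_flowXn ratfun_flowD ratfun_flowN ratfun_flowM.
    rewrite (ratfun_flow_nat 1) !ratfun_flow_nat fx fy ft fa.
    exact: (weyl_flow1 _ _ _ (rvar_neq0 0) two0).2.
  + by rewrite -/(rt R) ft rmorph1 xt1 ft.
  + rewrite -/(ra0 R) fa rmorph0 xa1 ratfun_flowD ratfun_flowN fa oppr0 addr0.
    by rewrite (ratfun_flow_nat 1).
- by rewrite !(ratfun_flowD, rmorphD) /= Ef Eg.
- by rewrite !(ratfun_flowM, rmorphM, rmorphD) /= Ef Eg.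
- have wf0 : weyl i f != 0 by rewrite fmorph_eq0.
  rewrite ratfun_flowV // rmorphN fmorphV /= fmorph_div rmorphXn /= Ef.
  by rewrite (ratfun_flowV wf0).
Qed.

(** * Action of words on the field of rational functions *)

Lemma weyl_word_is_autom w : is_autom (word_val weyl w).
Proof.
elim: w => [|i w [IHB [IH1 IHM] IHC IHbij]].
  by split => //; exists id.
split=> [f g||c|] /=.
- by rewrite IHB rmorphB.
- by split=> [|f g] /=; rewrite ?IH1 ?rmorph1 // IHM rmorphM.
- by rewrite IHC weyl_cst.
- exact: bij_comp (inv_bij (weylK i)) IHbij.
Qed.

Lemma weyl_word_t w : word_val weyl w t = t.
Proof.
by elim: w => //= i w ->; elim/ord2_ind: i; [case: weylE0|case: weylE1].
Qed.

(** The formula on the root lattice with delta specialized to 1. *)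
Lemma weyl_word_a0 w : word_val weyl w a0 =
  rcst ((-1) ^+ (word_code w).1 : int)%:~R * a0 + rcst (word_code w).2%:~R.
Proof.
elim: w => [|i w IH] /=; first by rewrite !rmorph1 mul1r !rmorph0 addr0.
rewrite IH rmorphD rmorphM /= !weyl_cst; case: (word_code w) => b n /=.
rewrite signrN !rmorphN /= mulNr.
have [_ _ _ wa0] := weylE0; have [_ _ _ wa1] := weylE1.
elim/ord2_ind: i => /=; first by rewrite wa0 mulrN.
by rewrite wa1 intrD rmorphD /= mulrBr mulr1 addrAC [LHS]addrC (addrC (rcst _)).
Qed.

Lemma weyl_word_flow w f :
  word_val weyl w (ratfun_flow f) = ratfun_flow (word_val weyl w f).
Proof. by elim: w => //= i w ->; rewrite weyl_flow. Qed.

Lemma weyl_word_code w w' :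
  word_val weyl w = word_val weyl w' -> word_code w = word_code w'.
Proof.
move=> eq_w; have := weyl_word_a0 w; rewrite eq_w weyl_word_a0.
case: (word_code w) (word_code w') => [b n] [b' n'] /= eq_a0.
(* The equality of rational functions is evaluated at alpha0 = c; then c = 0 recovers n and c = 1
   the sign. *)
have ev (c : C) : ((-1) ^+ b' : int)%:~R * c + n'%:~R =
    ((-1) ^+ b : int)%:~R * c + n%:~R.
  pose v := Defs.point 0 0 0 c.
  have val (e m : C) : has_value (rcst e * a0 + rcst m) v (e * c + m).
    apply: has_valueD (has_value_cst _ _).
    apply: has_valueM (has_value_cst _ _) _.
    exact: (has_value_var 3 v).
  by apply: has_value_uniq (val _ _); rewrite -eq_a0; apply: val.
have := ev 0; rewrite !mulr0 !add0r => /intr_inj en.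
have := ev 1; rewrite en !mulr1 => /addIr/intr_inj.
by case: b {eq_a0 ev}; case: b'.
Qed.

End WeylAction.

Local Close Scope classical_set_scope.

Theorem theorem4p1 (R : realType) :
  let x := rx R in let y := ry R in let t := rt R in
  let a0 := ra0 R in let a1 := ra1 R in
  exists s : 'I_2 -> ratfun R -> ratfun R,
    [/\ [/\ s 0 x = x + a0 / y, s 0 y = y, s 0 t = t,
            s 0 a0 = - a0 & s 0 a1 = a1 + 4 * a0],
        [/\ s 1 x = - x, s 1 y = - y + a1 / x - t / x ^+ 2 - 2 / x ^+ 4,
            s 1 t = t, s 1 a0 = a0 + a1 & s 1 a1 = - a1],
        backlund (s 0) /\ backlund (s 1),
        (forall g, generated s g -> backlund g)
      & is_weyl_A22 s].
Proof.
move=> x y t a0 a1; exists (@weyl R).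
have [x0 y0 t0 a00] := weylE0 R; have [x1 y1 t1 a01] := weylE1 R.
(* All words are treated at once, so no closure of [backlund] under composition is called for. *)
have wB w : backlund (word_val (@weyl R) w).
  apply: backlund_flow (weyl_word_is_autom R w) (weyl_word_t R w)
    (weyl_word_a0 R w) _.
  exact: weyl_word_flow.
have wa1 i : weyl i a1 = 1 - 2 * weyl i a0.
  by rewrite /a1 rmorphB rmorph1 rmorphM rmorph_nat.
split.
- have eq_a1 (L : comNzRingType) (a : L) : 1 - 2 * - a = 1 - 2 * a + 4 * a.
    by ring.
  by split=> //; rewrite wa1 a00; apply: eq_a1.
- have eq_a0 (L : comNzRingType) (a : L) : 1 - a = a + (1 - 2 * a) by ring.
  have eq_a1 (L : comNzRingType) (a : L) : 1 - 2 * (1 - a) = - (1 - 2 * a).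
    by ring.
  by split=> //; [rewrite a01; apply: eq_a0 | rewrite wa1 a01; apply: eq_a1].
- by split; [exact: (wB [:: 0])|exact: (wB [:: 1])].
- by move=> g /generatedP-/(_ (@weylK R))[w ->].
- apply: is_weyl_A22_code; first exact: weylK.
  + exact: weyl_word_code.
  + exact: simple_reflectionK.
  + exact: simple_reflection_code.
Qed.
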